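(* For real $\alpha,\nu$ and $x>0$ let $$d_{\alpha}(\nu,x)=\frac{x}{\tau+\sqrt{\tau^2+x^2}},\qquad \tau=\nu-\tfrac12(\alpha+1).$$ Then for all $x>0$ $$\frac{K_{\nu-1}(x)}{K_{\nu}(x)}\ge d_{0}(\nu,x)=\frac{x}{\nu-1/2+\sqrt{(\nu-1/2)^2+x^2}},\qquad \nu\ge 1/2,$$ where the equality only holds for $\nu=1/2$, and $$\frac{K_{\nu-1}(x)}{K_{\nu}(x)}<d_{1}(\nu,x)=\frac{x}{\nu-1+\sqrt{(\nu-1)^2+x^2}},\qquad \nu\in\mathbb{R}.$$ These bounds are the best possible of the form $d_\alpha(\nu,x)$, $\alpha\in\mathbb{R}$, in their range of validity. That is: if $\alpha\in\mathbb{R}$ is such that $d_\alpha(\nu,x)$ is a lower bound for $K_{\nu-1}(x)/K_\nu(x)$ for all $\nu\ge 1/2$ and $x>0$, then $d_\alpha(\nu,x)\le d_0(\nu,x)$ for all $\nu\ge1/2$, $x>0$; and if $\alpha\in\mathbb{R}$ is such that $d_\alpha(\nu,x)$ is an upper bound for $K_{\nu-1}(x)/K_\nu(x)$ for all $\nu\in\mathbb{R}$ and $x>0$, then $d_1(\nu,x)\le d_\alpha(\nu,x)$ for all $\nu\in\mathbb{R}$, $x>0$.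
   Context: $K_\nu$ denotes the modified Bessel function of the second kind of real order $\nu$; the parameter $\alpha$ is a constant independent of $\nu$ and $x$. *)

(* Defs.v *)
From HB Require Import structures.
From mathcomp Require Import all_boot all_order all_algebra.
From mathcomp Require Import all_classical all_reals all_analysis.

Set Implicit Arguments.
Unset Strict Implicit.
Unset Printing Implicit Defensive.

Import Order.TTheory GRing.Theory Num.Theory.
Import numFieldNormedType.Exports.

Local Open Scope classical_set_scope.
Local Open Scope ring_scope.

Definition cosh (R : realType) (t : R) : R := (expR t + expR (- t)) / 2.

(* Modified Bessel function of the second kind (Macdonald function)
     K_nu(x) = int_0^oo exp(- x cosh t) cosh(nu t) dt     (DLMF 10.32.9),
   valid for every real order nu and every x > 0, where the integrand is
   positive and Lebesgue integrable; integer and non-integer orders are treated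
   uniformly.  Rintegral is total: for x <= 0 the value is meaningless. *)
Definition besselK (R : realType) (nu x : R) : R :=
  Rintegral lebesgue_measure `[0, +oo[
    (fun t : R => expR (- (x * cosh t)) * cosh (nu * t)).

Definition tau (R : realType) (alpha nu : R) : R :=
  nu - 1 / 2 * (alpha + 1).

Definition d (R : realType) (alpha nu x : R) : R :=
  x / (tau alpha nu + Num.sqrt (tau alpha nu ^+ 2 + x ^+ 2)).

(* Main.v *)
(* Since d = d_alpha(nu, x) is the positive root of x d^2 + 2 tau d = x, a bound
   on r = K_(nu-1)/K_nu by d is a quadratic inequality in r.  The recurrence
   x (K_(nu+1) - K_(nu-1)) = 2 nu K_nu, an integration by parts, turns the upper
   bound by d_1 into the Turan inequality K_(nu-1)^2 < K_nu K_(nu-2) (strict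
   log-convexity in the order), and the lower bound by d_0 into
   (K_nu + K_(nu-2)) K_nu < (K_(nu+1) + K_(nu-1)) K_(nu-1), which is Chebyshev's
   correlation inequality for the increasing functions cosh t and
   cosh(nu t) / cosh((nu-1) t).  Optimality is tested where the ratio is
   elementary: r = 1 at nu = 1/2, and r = x / (1 + x) at nu = 3/2. *)
Require Import Defs.
From mathcomp Require Import all_boot all_order all_algebra.
From mathcomp Require Import all_classical all_reals all_analysis.
From mathcomp Require Import ring lra measurable_realfun.
Set Implicit Arguments.
Unset Strict Implicit.
Unset Printing Implicit Defensive.
Import Order.TTheory GRing.Theory Num.Theory.
Import numFieldNormedType.Exports.
Local Open Scope ring_scope.
Local Open Scope classical_set_scope.

(** * The bounds as positive roots of a quadratic *)

Lemma d_gt0 (R : realType) (alpha nu x : R) : 0 < x -> 0 < d alpha nu x.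
Proof.
move=> x0; rewrite /d divr_gt0//; set t := tau alpha nu.
suff : `|t| < Num.sqrt (t ^+ 2 + x ^+ 2).
  by have := ler_norm (- t); rewrite normrN => *; lra.
by rewrite -sqrtr_sqr ltr_sqrt ?ltrDl ?exprn_gt0// ltr_wpDl ?sqr_ge0 ?exprn_gt0.
Qed.

Lemma d_quadratic (R : realType) (alpha nu x : R) : 0 < x ->
  x * d alpha nu x ^+ 2 + 2 * tau alpha nu * d alpha nu x = x.
Proof.
move=> x0; have := d_gt0 alpha nu x0; rewrite /d; set t := tau alpha nu.
set s := Num.sqrt _ => d0.
have s2 : s ^+ 2 = t ^+ 2 + x ^+ 2 by rewrite sqr_sqrtr// addr_ge0// sqr_ge0.
have ts0 : t + s != 0 by apply: contraTneq d0 => ->; rewrite invr0 mulr0 ltxx.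
have -> : x * (x / (t + s)) ^+ 2 + 2 * t * (x / (t + s))
  = x * (x ^+ 2 + 2 * t * (t + s)) / (t + s) ^+ 2 by field.
have -> : x ^+ 2 = s ^+ 2 - t ^+ 2 by rewrite s2; ring.
by field.
Qed.

(** The two roots have product -1, so the second one is [- 1 / d]. Its factor is positive for
    [r > 0], and the sign of the quadratic at [r] decides on which side of [d] the number [r]
    lies. *)
Lemma d_factor (R : realType) (alpha nu x r : R) : 0 < x ->
  x * r ^+ 2 + 2 * tau alpha nu * r - x
  = (r - d alpha nu x) * (x * r + x / d alpha nu x).
Proof.
move=> x0; have d0 := d_gt0 alpha nu x0; have := d_quadratic alpha nu x0.
move: d0; set D := d alpha nu x; set t := tau alpha nu => d0 dq.
have -> : x / D = x * D + 2 * t.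
  by rewrite -[X in X / _]dq; field; rewrite gt_eqF.
transitivity (x * r ^+ 2 + 2 * t * r - (x * D ^+ 2 + 2 * t * D)).
  by rewrite dq.
ring.
Qed.

Lemma lt_d (R : realType) (alpha nu x r : R) : 0 < x -> 0 < r ->
  (r < d alpha nu x) = (x * r ^+ 2 + 2 * tau alpha nu * r < x).
Proof.
move=> x0 r0; rewrite -subr_lt0 -[RHS]subr_lt0 d_factor// pmulr_llt0//.
by rewrite addr_gt0// ?mulr_gt0// invr_gt0 d_gt0.
Qed.

Lemma gt_d (R : realType) (alpha nu x r : R) : 0 < x -> 0 < r ->
  (d alpha nu x < r) = (x < x * r ^+ 2 + 2 * tau alpha nu * r).
Proof.
move=> x0 r0; rewrite -subr_gt0 -[RHS]subr_gt0 d_factor// pmulr_lgt0//.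
by rewrite addr_gt0// ?mulr_gt0// invr_gt0 d_gt0.
Qed.

(** [tau] decreases in [alpha], so the quadratic for [beta] is at most [x] at the root for [alpha].
    Optimality thereby reduces to comparing [alpha] with 0 or 1. *)
Lemma le_d_alpha (R : realType) (alpha beta nu x : R) : 0 < x ->
  alpha <= beta -> d alpha nu x <= d beta nu x.
Proof.
move=> x0 ab; have a0 := d_gt0 alpha nu x0.
rewrite leNgt gt_d// -leNgt -[leRHS](d_quadratic alpha nu x0) lerD2l.
rewrite ler_pM2r// ler_pM2l// /tau; lra.
Qed.

(** * Hyperbolic functions and monotonicity of a ratio of cosines *)

Definition sinh (R : realType) (t : R) : R := (expR t - expR (- t)) / 2.

Lemma sinh_gt0 (R : realType) (t : R) : 0 < t -> 0 < sinh t.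
Proof.
move=> t0; rewrite /sinh divr_gt0// subr_gt0 ltr_expR; lra.
Qed.

Lemma cosh_gt0 (R : realType) (t : R) : 0 < cosh t.
Proof. by rewrite /cosh divr_gt0// addr_gt0// expR_gt0. Qed.

Lemma coshN (R : realType) (t : R) : cosh (- t) = cosh t.
Proof. by rewrite /cosh opprK addrC. Qed.

Lemma coshM (R : realType) (a b : R) :
  cosh a * cosh b = (cosh (a + b) + cosh (a - b)) / 2.
Proof. by rewrite /cosh !opprD opprK !expRD; field. Qed.

Lemma sinhM (R : realType) (a b : R) :
  sinh a * sinh b = (cosh (a + b) - cosh (a - b)) / 2.
Proof. by rewrite /cosh /sinh !opprD opprK !expRD; field. Qed.

Lemma lt_cosh (R : realType) (s t : R) : 0 <= s -> s < t -> cosh s < cosh t.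
Proof.
move=> s0 st; rewrite -subr_gt0.
have := sinhM ((t + s) / 2) ((t - s) / 2).
have -> : (t + s) / 2 + (t - s) / 2 = t by field.
have -> : (t + s) / 2 - (t - s) / 2 = s by field.
have : 0 < sinh ((t + s) / 2) * sinh ((t - s) / 2).
  by rewrite mulr_gt0// sinh_gt0//; lra.
by move=> + E; rewrite E; lra.
Qed.

(** By the product formulas the difference of the two sides is a sum of two products of [sinh],
    whose arguments are all positive because [2 * nu - 1 > 0]. *)
Lemma cosh_ratio_lt (R : realType) (nu s t : R) : 1 / 2 < nu -> 0 <= s -> s < t ->
  cosh (nu * s) * cosh ((nu - 1) * t) < cosh (nu * t) * cosh ((nu - 1) * s).
Proof.
move=> nu2 s0 st; rewrite -subr_gt0 !coshM.
have := sinhM ((2 * nu - 1) * (s + t) / 2) ((t - s) / 2).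
have := sinhM ((s + t) / 2) ((2 * nu - 1) * (t - s) / 2).
have : 0 < sinh ((2 * nu - 1) * (s + t) / 2) * sinh ((t - s) / 2).
  by rewrite mulr_gt0// sinh_gt0 ?divr_gt0 ?mulr_gt0//; lra.
have : 0 < sinh ((s + t) / 2) * sinh ((2 * nu - 1) * (t - s) / 2).
  by rewrite mulr_gt0// sinh_gt0 ?divr_gt0 ?mulr_gt0//; lra.
move=> + + E1 E2; rewrite {}E1 {}E2.
have -> : (2 * nu - 1) * (s + t) / 2 + (t - s) / 2
  = nu * t + (nu - 1) * s by field.
have -> : (2 * nu - 1) * (s + t) / 2 - (t - s) / 2
  = nu * s + (nu - 1) * t by field.
have -> : (s + t) / 2 - (2 * nu - 1) * (t - s) / 2
  = nu * s - (nu - 1) * t by field.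
have -> : (s + t) / 2 + (2 * nu - 1) * (t - s) / 2
  = nu * t - (nu - 1) * s by field.
lra.
Qed.

(** * Half-line integrals of exponentially decaying functions *)

(** One bound serves twice: it gives integrability, hence linearity of the integral, and it removes
    the boundary term at infinity in integrations by parts. *)
Definition expdecay (R : realType) (f : R -> R) : Prop :=
  continuous f /\ exists C, forall t, 0 <= t -> `|f t| <= C * expR (- t).

Lemma expdecayD (R : realType) (f g : R -> R) :
  expdecay f -> expdecay g -> expdecay (fun t => f t + g t).
Proof.
move=> [cf [A fA]] [cg [B gB]]; split.
  by move=> t; apply: continuousD; [exact: cf|exact: cg].
exists (A + B) => t t0; rewrite mulrDl (le_trans (ler_normD _ _))//.
by rewrite lerD ?fA ?gB.
Qed.

Lemma expdecayZ (R : realType) (c : R) (f : R -> R) :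
  expdecay f -> expdecay (fun t => c * f t).
Proof.
move=> [cf [A fA]]; split.
  by move=> t; apply: continuousM; [exact: cst_continuous|exact: cf].
exists (`|c| * A) => t t0; rewrite normrM -mulrA ler_wpM2l//.
exact: fA.
Qed.

Lemma expdecay_expRN (R : realType) : expdecay (fun t : R => expR (- t)).
Proof.
split; last by exists 1 => t t0; rewrite mul1r ger0_norm// expR_ge0.
move=> t; apply: continuous_comp; last exact: continuous_expR.
exact: continuousN.
Qed.

Definition halfint (R : realType) (f : R -> R) : R :=
  Rintegral (@lebesgue_measure R) `[0, +oo[ f.

Lemma cvg_expRN (R : realType) : expR (- t) @[t --> +oo] --> (0 : R).
Proof. exact: cvgr_expR. Qed.

Lemma integrable_expRN (R : realType) :
  (@lebesgue_measure R).-integrable `[0, +oo[ (EFin \o (fun t : R => expR (- t))).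
Proof.
have intT := @integrable_exponential_pdf R 1 ltr01.
apply: eq_integrable (integrableS measurableT _ (@subsetT _ _) intT) => // t; rewrite inE/= in_itv/= andbT => t0.
by rewrite /= exponential_pdfE// mul1r mulN1r.
Qed.

Lemma integrable_expdecay (R : realType) (f : R -> R) : expdecay f ->
  (@lebesgue_measure R).-integrable `[0, +oo[ (EFin \o f).
Proof.
move=> [cf [C fC]].
apply: le_integrable (integrableZl _ C (integrable_expRN R)) => //.
- apply/measurable_EFinP/measurable_funTS.
  exact: continuous_measurable_fun.
- move=> t; rewrite /= in_itv/= andbT => t0; rewrite lee_fin.
  by rewrite (le_trans (fC _ t0))// ler_norm.
Qed.

Lemma halfintD (R : realType) (f g : R -> R) : expdecay f -> expdecay g ->
  halfint (fun t => f t + g t) = halfint f + halfint g.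
Proof. by move=> ef eg; rewrite /halfint RintegralD//; exact: integrable_expdecay. Qed.

Lemma halfintZ (R : realType) (c : R) (f : R -> R) : expdecay f ->
  halfint (fun t => c * f t) = c * halfint f.
Proof. by move=> ef; rewrite /halfint RintegralZl//; exact: integrable_expdecay. Qed.

(** A zero integral would make [f] vanish almost everywhere. Asking for strict positivity only
    beyond [a] leaves room for integrands with a zero. *)
Lemma halfint_gt0 (R : realType) (a : R) (f : R -> R) : expdecay f ->
  (forall t, 0 <= t -> 0 <= f t) -> (forall t, 0 <= t -> a < t -> 0 < f t) ->
  0 < halfint f.
Proof.
move=> ef f0 fa; have intf := integrable_expdecay ef.
rewrite lt0r; apply/andP; split; last first.
  by apply: Rintegral_ge0 => t /=; rewrite in_itv/= andbT; exact: f0.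
apply/eqP => If0.
have : (\int[lebesgue_measure]_(t in `[0%R, +oo[) `|(f t)%:E| = 0)%E.
  transitivity (\int[lebesgue_measure]_(t in `[0%R, +oo[) (f t)%:E)%E.
    apply: eq_integral => t; rewrite inE/= in_itv/= andbT => t0.
    by rewrite ger0_norm// f0.
  by rewrite -[LHS]fineK ?[X in X%:E]If0//; exact: integrable_fin_num.
case/integrableP : intf => mf _.
move=> abs0.
have [|N [mN N0 sN]] := (@ae_eq_integral_abs _ _ R (@lebesgue_measure R) _ _ _ mf).1 abs0.
  exact: measurable_itv.
(* An interval of length 1 to the right of both 0 and [a]; [f] is positive on it, so it would be
   contained in the null set [N]. *)
pose I : interval R := `[`|a| + 1, `|a| + 2]%R.
have : (lebesgue_measure [set` I] <= lebesgue_measure N)%E.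
  apply: le_measure; rewrite ?inE//.
  apply: subset_trans sN => t /=; rewrite in_itv/= => /andP[at1 _].
  have na := normr_ge0 a; have aa := ler_norm a.
  have t0 : 0 <= t by lra.
  rewrite in_itv/= andbT => /(_ t0) /eqP; rewrite eqe; apply/negP.
  by rewrite gt_eqF// fa//; lra.
rewrite N0 lebesgue_measure_itv/= lte_fin ifT; last by rewrite ltrD2l ltr1n.
by rewrite -EFinB lee_fin; lra.
Qed.

Lemma halfint_derive (R : realType) (F f : R -> R) : expdecay F -> expdecay f ->
  (forall t : R, is_derive t (1 : R) F (f t)) -> halfint f = - F 0.
Proof.
move=> [cF [B FB]] ef dF; have [cf [C fC]] := ef.
have eC := expdecayZ C (@expdecay_expRN R).
have cB c : c * expR (- t) @[t --> +oo] --> (0 : R).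
  by rewrite -[X in _ --> X](mulr0 c); apply: cvgMr; exact: cvg_expRN.
have F0 : F t @[t --> +oo] --> (0 : R).
  apply/norm_cvg0P.
  apply: (@squeeze_cvgr _ _ _ _ (cst 0) (fun t => B * expR (- t))).
  - by near=> t; rewrite normr_ge0/= FB.
  - exact: cvg_cst.
  - exact: cB.
have intE (G g : R -> R) : continuous g -> (forall t, 0 <= t -> 0 <= g t) ->
    G t @[t --> +oo] --> (0 : R) -> (forall t : R, is_derive t (1 : R) G (g t)) ->
    halfint g = - G 0.
  move=> cg g0 G0 dG; rewrite -[RHS]add0r.
  apply: Rintegral_ge0_continuous_FTC2y => //.
  - exact: continuous_subspaceT.
  - apply: cvg_at_right_filter; apply: differentiable_continuous.
    by apply/derivable1_diffP; have [] := dG 0.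
  - by move=> t _; rewrite derive1E; have [_ ->] := dG t.
have dC (t : R) : is_derive t (1 : R) (fun t => - C * expR (- t)) (C * expR (- t)).
  apply: is_derive_eq; rewrite /GRing.scale/=; ring.
(* Adding C * exp(-t) makes the integrand nonnegative, as the half-line
   fundamental theorem of calculus requires. *)
have IC : halfint (fun t => C * expR (- t)) = - (- C * expR (- 0)).
  apply: (intE (fun t => - C * expR (- t))) => //; first exact: (proj1 eC).
  by move=> t t0; rewrite (le_trans _ (fC t t0)).
have : halfint (fun t => f t + C * expR (- t)) = - (F 0 + - C * expR (- 0)).
  apply: (intE (fun t => F t + - C * expR (- t))).
  - exact: (proj1 (expdecayD ef eC)).
  - move=> t t0; have := fC _ t0; have := ler_norm (- f t); rewrite normrN.
    lra.
  - by rewrite -[X in _ --> X](addr0 (0 : R)); apply: cvgD => //; exact: cB.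
rewrite halfintD// IC; lra.
Unshelve. all: by end_near. Qed.

(** * The Bessel integrand and the three-term recurrence *)

#[local] Instance is_derive_cosh (R : realType) (t : R) :
  is_derive t (1 : R) (@cosh R) (sinh t).
Proof.
by rewrite /cosh /sinh; apply: is_derive_eq; rewrite /GRing.scale/=; field.
Qed.

#[local] Instance is_derive_sinh (R : realType) (t : R) :
  is_derive t (1 : R) (@sinh R) (cosh t).
Proof.
by rewrite /cosh /sinh; apply: is_derive_eq; rewrite /GRing.scale/=; field.
Qed.

(** Obtained by squaring [1 + t / 2 <= expR (t / 2)]. Quadratic growth already outweighs any linear
    exponent [a * t]. *)
Lemma cosh_ge_sqr (R : realType) (t : R) : 0 <= t -> t ^+ 2 / 8 <= cosh t.
Proof.
move=> t0; have := expR_ge1Dx (t / 2); have := expR_gt0 (- t).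
have : expR t = expR (t / 2) ^+ 2 by rewrite -expRM_natl; congr expR; field.
by rewrite /cosh => ->; nra.
Qed.

Lemma expdecay_expR (R : realType) (x a : R) : 0 < x ->
  expdecay (fun t => expR (- (x * cosh t)) * expR (a * t)).
Proof.
move=> x0; split.
  move=> t; apply: differentiable_continuous; apply/derivable1_diffP.
  exact: ex_derive.
(* The exponent is the maximum over [t] of [(a + 1) * t - x * t ^+ 2 / 8], found by completing the
   square. *)
exists (expR (2 * (a + 1) ^+ 2 / x)) => t t0.
rewrite -!expRD ger0_norm ?expR_ge0// ler_expR.
have : 0 <= (x * t / 4 - (a + 1)) ^+ 2 / x.
  by rewrite divr_ge0 ?sqr_ge0 ?ltW.
have : x * (t ^+ 2 / 8) <= x * cosh t by rewrite ler_pM2l// cosh_ge_sqr.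
have -> : (x * t / 4 - (a + 1)) ^+ 2 / x
  = x * t ^+ 2 / 16 - t * (a + 1) / 2 + (a + 1) ^+ 2 / x.
  by field; rewrite gt_eqF.
lra.
Qed.

Definition besselK_integrand (R : realType) (x nu t : R) : R :=
  expR (- (x * cosh t)) * cosh (nu * t).

Lemma expdecay_integrand (R : realType) (x nu : R) : 0 < x ->
  expdecay (besselK_integrand x nu).
Proof.
move=> x0.
have -> : besselK_integrand x nu = fun t =>
    2^-1 * (expR (- (x * cosh t)) * expR (nu * t)
            + expR (- (x * cosh t)) * expR (- nu * t)).
  by apply/funext => t; rewrite /besselK_integrand mulNr /cosh; field.
by apply: expdecayZ; apply: expdecayD; exact: expdecay_expR.
Qed.

Lemma besselKE (R : realType) (nu x : R) :
  besselK nu x = halfint (besselK_integrand x nu).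
Proof. by []. Qed.

Lemma besselK_gt0 (R : realType) (nu x : R) : 0 < x -> 0 < besselK nu x.
Proof.
move=> x0; rewrite besselKE.
apply: (@halfint_gt0 _ 0); first exact: expdecay_integrand.
  by move=> t _; rewrite ltW// mulr_gt0 ?expR_gt0 ?cosh_gt0.
by move=> t _ _; rewrite mulr_gt0 ?expR_gt0 ?cosh_gt0.
Qed.

Lemma besselKN (R : realType) (nu x : R) : besselK (- nu) x = besselK nu x.
Proof.
rewrite !besselKE; congr halfint; apply/funext => t.
by rewrite /besselK_integrand mulNr coshN.
Qed.

(** The function [expR (- (x * cosh t)) * sinh (nu * t)] vanishes at 0 and at infinity, so its
    derivative has integral 0; [sinhM] splits the term in [sinh (nu * t) * sinh t] into the orders
    [nu + 1] and [nu - 1]. *)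
Lemma besselK_recurrence (R : realType) (nu x : R) : 0 < x ->
  x * (besselK (nu + 1) x - besselK (nu - 1) x) = 2 * nu * besselK nu x.
Proof.
move=> x0; rewrite !besselKE.
set f := fun mu => besselK_integrand x mu.
have df mu : expdecay (f mu) by exact: expdecay_integrand.
pose F t := expR (- (x * cosh t)) * sinh (nu * t).
have dF : expdecay F.
  have -> : F = fun t => 2^-1 * (expR (- (x * cosh t)) * expR (nu * t)
            + -1 * (expR (- (x * cosh t)) * expR (- nu * t))).
    by apply/funext => t; rewrite /F (mulNr nu) /sinh; field.
  apply: expdecayZ; apply: expdecayD; first exact: expdecay_expR.
  by apply: expdecayZ; exact: expdecay_expR.
have : halfint (fun t => nu * f nu t
    + (- x / 2 * f (nu + 1) t + x / 2 * f (nu - 1) t)) = - F 0.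
  apply: halfint_derive => //.
    by apply: expdecayD; [|apply: expdecayD]; exact: expdecayZ.
  move=> t; rewrite /f /F /besselK_integrand.
  have := sinhM (nu * t) t.
  have -> : nu * t + t = (nu + 1) * t by ring.
  have -> : nu * t - t = (nu - 1) * t by ring.
  move=> shE; apply: is_derive_eq; rewrite /GRing.scale/=.
  transitivity (nu * (expR (- (x * cosh t)) * cosh (nu * t))
    - x * expR (- (x * cosh t)) * (sinh (nu * t) * sinh t)); first by ring.
  by rewrite shE; field.
have -> : F 0 = 0 by rewrite /F mulr0 /sinh oppr0 subrr mul0r mulr0.
rewrite !halfintD ?halfintZ//.
- lra.
- exact: expdecayZ.
- exact: expdecayZ.
- exact: expdecayZ.
- by apply: expdecayD; exact: expdecayZ.
Qed.

(** * The Turan inequality *)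

Lemma besselK_quadratic_gt0 (R : realType) (nu x c : R) : 0 < x ->
  0 < besselK (nu + 1) x + (2 * c * besselK nu x + c ^+ 2 * besselK (nu - 1) x).
Proof.
move=> x0; rewrite !besselKE.
have df mu : expdecay (besselK_integrand x mu) by exact: expdecay_integrand.
rewrite -!halfintZ// -!halfintD//; do ?[exact: expdecayZ];
  last by apply: expdecayD; exact: expdecayZ.
set g := fun t => _.
(* Over the whole line the sum is half the integral of [expR (- (x * cosh t)) * expR ((nu - 1) * t)
   * (expR t + c) ^+ 2]; here [t] and [- t] are folded together. *)
have gE t : g t = expR (- (x * cosh t)) / 2 *
   (expR (nu * t) * expR (- t) * (expR t + c) ^+ 2
    + expR (- (nu * t)) * expR t * (expR (- t) + c) ^+ 2).
  rewrite /g /besselK_integrand /cosh !mulrDl !mulNr !mul1r !opprD opprK !expRD.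
  have := expRxMexpNx_1 t; move: (expR t) (expR (- t)) => p q pq.
  have E1 : q * (p + c) ^+ 2 = p + 2 * c + c ^+ 2 * q.
    transitivity (p * (p * q) + 2 * c * (p * q) + c ^+ 2 * q); first by ring.
    by rewrite pq; ring.
  have E2 : p * (q + c) ^+ 2 = q + 2 * c + c ^+ 2 * p.
    transitivity (q * (p * q) + 2 * c * (p * q) + c ^+ 2 * p); first by ring.
    by rewrite pq; ring.
  rewrite -[_ * q * _ in RHS]mulrA E1 -[_ * p * _ in RHS]mulrA E2.
  by field.
apply: (@halfint_gt0 _ 0).
- by apply: expdecayD => //; apply: expdecayD; exact: expdecayZ.
- move=> t _; rewrite gE mulr_ge0 ?divr_ge0 ?expR_ge0// addr_ge0//.
    by rewrite mulr_ge0 ?sqr_ge0// mulr_ge0 ?expR_ge0.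
  by rewrite mulr_ge0 ?sqr_ge0// mulr_ge0 ?expR_ge0.
- move=> t _ t0; rewrite gE mulr_gt0 ?divr_gt0 ?expR_gt0//.
  have ep : expR (- t) < expR t by rewrite ltr_expR; lra.
  have ge0 a b e : 0 <= expR a * expR b * e ^+ 2 :> R.
    by rewrite mulr_ge0 ?sqr_ge0// mulr_ge0 ?expR_ge0.
  have gt0 a b e : e != 0 -> 0 < expR a * expR b * e ^+ 2 :> R.
    by move=> e0; rewrite mulr_gt0 ?exprn_even_gt0// mulr_gt0 ?expR_gt0.
  (* For [t > 0] the two squares cannot vanish together, since [expR (- t) < expR t]. *)
  have [tc|tc] := eqVneq (expR t + c) 0.
    by rewrite ltr_wpDl// gt0//; lra.
  by rewrite ltr_wpDr// gt0.
Qed.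

(** The quadratic in [c] above is taken at its minimiser, where its positivity is the sign of the
    discriminant. *)
Lemma besselK_turan (R : realType) (nu x : R) : 0 < x ->
  besselK nu x ^+ 2 < besselK (nu + 1) x * besselK (nu - 1) x.
Proof.
move=> x0; have K0 := besselK_gt0 (nu - 1) x0.
have := besselK_quadratic_gt0 nu (- (besselK nu x / besselK (nu - 1) x)) x0.
move: K0; move: (besselK (nu + 1) x) (besselK nu x) (besselK (nu - 1) x).
move=> a b c c0 H; rewrite -subr_gt0.
have -> : a * c - b ^+ 2 = c * (a + (2 * - (b / c) * b + (- (b / c)) ^+ 2 * c)).
  by field; rewrite gt_eqF.
exact: mulr_gt0.
Qed.

(** * The correlation inequality *)

Lemma cosh_ratio_crossing (R : realType) (nu c a b : R) : 1 / 2 < nu ->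
    0 <= a -> 0 <= b ->
    cosh (nu * a) <= c * cosh ((nu - 1) * a) ->
    c * cosh ((nu - 1) * b) <= cosh (nu * b) ->
  exists2 t0, 0 <= t0 & forall t, 0 <= t ->
    (t < t0 -> cosh (nu * t) < c * cosh ((nu - 1) * t)) /\
    (t0 < t -> c * cosh ((nu - 1) * t) < cosh (nu * t)).
Proof.
move=> nu2 a0 b0 ha hb.
(* This ratio is continuous and strictly increasing on [t >= 0], at most [c] at [a] and at least [c]
   at [b]; it takes the value [c] at some [t0] between them and changes sides only there. *)
pose f t := cosh (nu * t) / cosh ((nu - 1) * t).
have fc : continuous f.
  move=> t; apply: differentiable_continuous; apply/derivable1_diffP.
  have := cosh_gt0 ((nu - 1) * t) => /lt0r_neq0 ?.
  exact: ex_derive.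
have flt s t : 0 <= s -> s < t -> f s < f t.
  move=> s0 st; rewrite /f ltr_pdivrMr ?cosh_gt0// mulrAC.
  by rewrite ltr_pdivlMr ?cosh_gt0// cosh_ratio_lt.
have fa : f a <= c by rewrite ler_pdivrMr ?cosh_gt0.
have fb : c <= f b by rewrite ler_pdivlMr ?cosh_gt0.
have ab : a <= b.
  rewrite leNgt; apply/negP => /(flt _ _ b0); lra.
have [|t0 t0ab ft0] := IVT ab (continuous_subspaceT fc) (v := c).
  by rewrite ge_min fa le_max fb orbT.
have t00 : 0 <= t0 by move: t0ab; rewrite in_itv/= => /andP[+ _]; lra.
exists t0 => // t tge; split => tt0.
- by rewrite -ltr_pdivrMr ?cosh_gt0// -/(f t) -ft0 flt.
- by rewrite -ltr_pdivlMr ?cosh_gt0// -/(f t) -ft0 flt.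
Qed.

Lemma besselK_chebyshev (R : realType) (nu x : R) : 1 / 2 < nu -> 0 < x ->
  (besselK nu x + besselK (nu - 2) x) * besselK nu x
    < (besselK (nu + 1) x + besselK (nu - 1) x) * besselK (nu - 1) x.
Proof.
move=> nu2 x0.
have df mu : expdecay (besselK_integrand x mu) by exact: expdecay_integrand.
have K0 := besselK_gt0 (nu - 1) x0.
(* The mean of [cosh (nu * t) / cosh ((nu - 1) * t)] for the weight [besselK_integrand x (nu - 1)];
   this choice makes the integral of [h] zero. *)
pose c := besselK nu x / besselK (nu - 1) x.
pose h t := besselK_integrand x nu t + - c * besselK_integrand x (nu - 1) t.
have dh : expdecay h by apply: expdecayD => //; exact: expdecayZ.
have hE t : h t = expR (- (x * cosh t))
    * (cosh (nu * t) - c * cosh ((nu - 1) * t)).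
  by rewrite /h /besselK_integrand; ring.
have Ih : halfint h = 0.
  rewrite /h halfintD ?halfintZ//; last exact: expdecayZ.
  by rewrite -!besselKE /c; field; rewrite gt_eqF.
(* With integral 0, [h] can be neither positive throughout nor negative throughout, which supplies
   [a] and then [b]. *)
have [a a0 ha] : exists2 a, 0 <= a & cosh (nu * a) <= c * cosh ((nu - 1) * a).
  apply: contrapT => H; suff : 0 < halfint h by rewrite Ih ltxx.
  have hp t : 0 <= t -> 0 < h t.
    move=> t0; rewrite hE mulr_gt0 ?expR_gt0// subr_gt0 ltNge.
    by apply/negP => ?; apply: H; exists t.
  by apply: (@halfint_gt0 _ 0) => // t t0; rewrite ?ltW// hp.
have [b b0 hb] : exists2 b, 0 <= b & c * cosh ((nu - 1) * b) <= cosh (nu * b).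
  apply: contrapT => H.
  suff : 0 < halfint (fun t => -1 * h t) by rewrite halfintZ// Ih mulr0 ltxx.
  have hp t : 0 <= t -> 0 < -1 * h t.
    move=> t0; rewrite hE mulN1r -mulrN opprB mulr_gt0 ?expR_gt0// subr_gt0.
    by rewrite ltNge; apply/negP => ?; apply: H; exists t.
  apply: (@halfint_gt0 _ 0); first exact: expdecayZ.
    by move=> t t0; rewrite ltW// hp.
  by move=> t t0 _; exact: hp.
have [t0 t00 cross] := cosh_ratio_crossing nu2 a0 b0 ha hb.
(* k = h * (cosh t - cosh t0) is nonnegative, both factors changing sign at t0,
   and has the same integral as h * cosh t because h has integral 0. *)
pose k t := 2^-1 * ((besselK_integrand x (nu + 1) t
    + besselK_integrand x (nu - 1) t)
  + - c * (besselK_integrand x nu t + besselK_integrand x (nu - 2) t))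
  + - cosh t0 * h t.
have kE t : k t = expR (- (x * cosh t))
    * (cosh (nu * t) - c * cosh ((nu - 1) * t)) * (cosh t - cosh t0).
  have := coshM (nu * t) t; have := coshM ((nu - 1) * t) t.
  have -> : nu * t + t = (nu + 1) * t by ring.
  have -> : nu * t - t = (nu - 1) * t by ring.
  have -> : (nu - 1) * t + t = nu * t by ring.
  have -> : (nu - 1) * t - t = (nu - 2) * t by ring.
  move=> E1 E2; transitivity (expR (- (x * cosh t))
    * (cosh (nu * t) * cosh t - c * (cosh ((nu - 1) * t) * cosh t))
    - cosh t0 * h t); last by rewrite hE; ring.
  by rewrite E1 E2 /k /besselK_integrand; field.
have kt_gt0 t : 0 <= t -> t != t0 -> 0 < k t.
  move=> tge tt0; have [lo hi] := cross t tge; rewrite kE.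
  have e0 := expR_gt0 (- (x * cosh t)).
  have [tlt|tgt|/eqP] := ltgtP t t0; last by rewrite (negbTE tt0).
  - rewrite -mulrA mulr_gt0// nmulr_rgt0 subr_lt0; last exact: lo.
    exact: lt_cosh.
  - rewrite !mulr_gt0// subr_gt0; first exact: hi.
    exact: lt_cosh.
have dsum : expdecay (fun t => besselK_integrand x nu t
   + besselK_integrand x (nu - 2) t) by exact: expdecayD.
have dsum' : expdecay (fun t => besselK_integrand x (nu + 1) t
   + besselK_integrand x (nu - 1) t) by exact: expdecayD.
have dcs := expdecayZ (- c) dsum.
have dall := expdecayD dsum' dcs.
have : 0 < halfint k.
  apply: (@halfint_gt0 _ t0).
  - by apply: expdecayD; exact: expdecayZ.
  - move=> t tge; have [->|tt0] := eqVneq t t0; last by rewrite ltW// kt_gt0.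
    by rewrite kE subrr mulr0.
  - by move=> t tge t0t; rewrite kt_gt0// gt_eqF.
rewrite /k halfintD; [|exact: expdecayZ..].
rewrite !halfintZ// Ih mulr0 addr0 !halfintD// !halfintZ// !halfintD//.
(* Multiplying by [besselK (nu - 1) x] clears the denominator of [c]. *)
rewrite -!besselKE pmulr_rgt0// -(pmulr_rgt0 _ K0) => H; rewrite -subr_gt0.
suff <- : besselK (nu - 1) x * (besselK (nu + 1) x + besselK (nu - 1) x
    + - c * (besselK nu x + besselK (nu - 2) x))
  = (besselK (nu + 1) x + besselK (nu - 1) x) * besselK (nu - 1) x
    - (besselK nu x + besselK (nu - 2) x) * besselK nu x by [].
by rewrite /c; field; rewrite gt_eqF.
Qed.

(** * The two bounds and the ratio at orders 1/2 and 3/2 *)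

Lemma besselK_ratio_lt_d1 (R : realType) (nu x : R) : 0 < x ->
  besselK (nu - 1) x / besselK nu x < d 1 nu x.
Proof.
move=> x0; have K0 := besselK_gt0 nu x0; have K1 := besselK_gt0 (nu - 1) x0.
rewrite lt_d ?divr_gt0// /tau.
have := besselK_turan (nu - 1) x0; have := besselK_recurrence (nu - 1) x0.
rewrite subrK; set k := besselK (nu - 1 - 1) x.
move: K0 K1; move: (besselK nu x) (besselK (nu - 1) x) => a b a0 b0 rec tur.
(* After replacing [2 * (nu - 1) * b] by [x * (a - k)], the claim times [a ^+ 2] becomes
   [b ^+ 2 < a * k] up to the factor [x]. *)
have ->: x * (b / a) ^+ 2 + 2 * (nu - 1 / 2 * (1 + 1)) * (b / a)
  = (x * b ^+ 2 + (2 * (nu - 1) * b) * a) / a ^+ 2.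
  by field; rewrite gt_eqF.
by rewrite -rec ltr_pdivrMr ?exprn_gt0//; nra.
Qed.

Lemma besselK_ratio_gt_d0 (R : realType) (nu x : R) : 1 / 2 < nu -> 0 < x ->
  d 0 nu x < besselK (nu - 1) x / besselK nu x.
Proof.
move=> nu2 x0; have K0 := besselK_gt0 nu x0; have K1 := besselK_gt0 (nu - 1) x0.
rewrite gt_d ?divr_gt0// /tau.
have := besselK_chebyshev nu2 x0.
have := besselK_recurrence (nu - 1) x0; have := besselK_recurrence nu x0.
have -> : nu - 1 - 1 = nu - 2 by ring.
rewrite subrK; move: (besselK (nu - 2) x) (besselK (nu + 1) x).
move: K0 K1; move: (besselK nu x) (besselK (nu - 1) x) => a b a0 b0 m p.
move=> rec1 rec2; rewrite -(ltr_pM2l x0) => cheb.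
(* Eliminating [p] and [m] from [cheb] by the two recurrences leaves exactly twice the inequality [x
   * a ^+ 2 < x * b ^+ 2 + (2 * nu - 1) * b * a]. *)
have -> : x * (b / a) ^+ 2 + 2 * (nu - 1 / 2 * (0 + 1)) * (b / a)
  = (x * b ^+ 2 + (2 * nu - 1) * b * a) / a ^+ 2.
  by field; rewrite gt_eqF.
by rewrite ltr_pdivlMr ?exprn_gt0//; nra.
Qed.

Lemma besselK_half (R : realType) (x : R) :
  besselK (1 / 2 - 1) x = besselK (1 / 2) x.
Proof. by rewrite -besselKN; congr besselK; field. Qed.

Lemma d0_half (R : realType) (x : R) : 0 < x -> d 0 (1 / 2) x = 1.
Proof.
move=> x0; have -> : d 0 (1 / 2) x = x / (0 + Num.sqrt (0 ^+ 2 + x ^+ 2)).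
  by rewrite /d /tau add0r mulr1 subrr.
by rewrite expr0n/= !add0r sqrtr_sqr gtr0_norm// divff// gt_eqF.
Qed.

(** Orders 1/2 and -1/2 agree, so the recurrence at 1/2 involves only two values and yields the
    ratio without a closed form of either. *)
Lemma besselK_ratio_three_halves (R : realType) (x : R) : 0 < x ->
  besselK (3 / 2 - 1) x / besselK (3 / 2) x = x / (1 + x).
Proof.
move=> x0; have := besselK_recurrence (1 / 2) x0; rewrite besselK_half.
have -> : 1 / 2 + 1 = 3 / 2 :> R by field.
have -> : 3 / 2 - 1 = 1 / 2 :> R by field.
have K0 := besselK_gt0 (1 / 2) x0; have K1 := besselK_gt0 (3 / 2) x0.
move: K0 K1; move: (besselK (1 / 2) x) (besselK (3 / 2) x) => a b a0 b0 rec.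
have -> : b = a * (1 + x) / x.
  apply: (mulfI (lt0r_neq0 x0)); transitivity (2 * (1 / 2) * a + x * a).
    by rewrite -rec; ring.
  by field; rewrite gt_eqF.
by field; rewrite !gt_eqF// addr_gt0.
Qed.

Theorem theorem7 (R : realType) :
  (* lower bound, with its equality case *)
  (forall nu x : R, 1 / 2 <= nu -> 0 < x ->
     [/\ d 0 nu x <= besselK (nu - 1) x / besselK nu x,
         d 0 nu x = x / (nu - 1 / 2 + Num.sqrt ((nu - 1 / 2) ^+ 2 + x ^+ 2)) &
         besselK (nu - 1) x / besselK nu x = d 0 nu x <-> nu = 1 / 2]) /\
  (* upper bound *)
  (forall nu x : R, 0 < x ->
     besselK (nu - 1) x / besselK nu x < d 1 nu x /\
     d 1 nu x = x / (nu - 1 + Num.sqrt ((nu - 1) ^+ 2 + x ^+ 2))) /\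
  (* optimality of the lower bound *)
  (forall alpha : R,
     (forall nu x : R, 1 / 2 <= nu -> 0 < x ->
        d alpha nu x <= besselK (nu - 1) x / besselK nu x) ->
     forall nu x : R, 1 / 2 <= nu -> 0 < x -> d alpha nu x <= d 0 nu x) /\
  (* optimality of the upper bound *)
  (forall alpha : R,
     (forall nu x : R, 0 < x ->
        besselK (nu - 1) x / besselK nu x <= d alpha nu x) ->
     forall nu x : R, 0 < x -> d 1 nu x <= d alpha nu x).
Proof.
have ratio_half x : 0 < x -> besselK (1 / 2 - 1) x / besselK (1 / 2) x = 1 :> R.
  by move=> x0; rewrite besselK_half divff// gt_eqF// besselK_gt0.
split=> [nu x nu2 x0|].
  have half : nu = 1 / 2 -> besselK (nu - 1) x / besselK nu x = d 0 nu x.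
    by move=> ->; rewrite ratio_half// d0_half.
  split; last split=> // E.
  - move: nu2; rewrite le_eqVlt => /predU1P[/esym/half -> //|nu2].
    by rewrite ltW// besselK_ratio_gt_d0.
  - by rewrite /d /tau add0r mulr1.
  - move: nu2; rewrite le_eqVlt => /predU1P[//|/besselK_ratio_gt_d0 /(_ x0)].
    by rewrite E ltxx.
split=> [nu x x0|].
  split; first exact: besselK_ratio_lt_d1.
  by rewrite /d; have -> : tau 1 nu = nu - 1 by rewrite /tau; field.
split=> alpha H nu x.
  move=> _ x0; apply: le_d_alpha => //.
  (* At order 1/2 the ratio is 1 and [tau] equals [- alpha / 2], so a lower bound forces
     [alpha <= 0]. *)
  have := H (1 / 2) 1 (lexx _) ltr01; rewrite ratio_half//.
  by rewrite leNgt lt_d// -leNgt /tau; lra.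
move=> x0; apply: le_d_alpha => //; rewrite leNgt; apply/negP => a1.
(* At order 3/2 the bound fails at [x] exactly when [alpha * (1 + x) < 1]. The point [y] qualifies
   for every [alpha < 1], as [1 - alpha * (1 + y) = (1 - alpha) * (2 - alpha) / 2]. *)
pose y := (1 - alpha) / 2; have y0 : 0 < y by rewrite /y; lra.
have r0 : 0 < y / (1 + y) by rewrite divr_gt0// addr_gt0.
have := H (3 / 2) _ y0; rewrite besselK_ratio_three_halves// leNgt gt_d//.
apply/negP; rewrite negbK; have -> : tau alpha (3 / 2) = (1 + 2 * y) / 2.
  by rewrite /tau /y; field.
have -> : y * (y / (1 + y)) ^+ 2 + 2 * ((1 + 2 * y) / 2) * (y / (1 + y))
   = y * (y ^+ 2 + (1 + 2 * y) * (1 + y)) / (1 + y) ^+ 2.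
  by field; rewrite gt_eqF// addr_gt0.
by rewrite ltr_pdivlMr ?exprn_gt0 ?addr_gt0// ltr_pM2l//; nra.
Qed.
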